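(* Let $n\geq 4$ be an integer and let $M$ be a perfect matching of the folded hypercube $FQ_n$. Then $FQ_n-M$ (obtained from $FQ_n$ by deleting the edges of $M$) is isomorphic to the hypercube $Q_n$ if and only if $M=E_c$ or $M=E^i$ for some $i\in\{1,2,\dots,n\}$.
   Context: The $n$-dimensional hypercube $Q_n$ has vertex set $\{0,1\}^n$ (binary strings $x_1x_2\cdots x_n$), two vertices being adjacent iff they differ in exactly one position. The $n$-dimensional folded hypercube $FQ_n$ is obtained from $Q_n$ by adding the $2^{n-1}$ complementary edges joining each $x_1x_2\cdots x_n$ to $\overline{x}_1\overline{x}_2\cdots\overline{x}_n$, where $\overline{x}_i=1-x_i$. $E_c$ denotes the set of all complementary edges of $FQ_n$, and for $1\le i\le n$, $E^i$ denotes the set of $i$-dimensional edges of $Q_n$, i.e. edges $uv$ of $Q_n$ such that $u$ and $v$ differ only in the $i$-th position. A perfect matching of a graph $G$ is a set of pairwise vertex-disjoint edges covering every vertex. *)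

(* Defs.v *)
From HB Require Import structures.
From mathcomp Require Import all_boot.

Set Implicit Arguments.
Unset Strict Implicit.
Unset Printing Implicit Defensive.

(* A simple graph on a finite vertex type [T] is given by its edge set
   [E : {set {set T}}], whose members are two-element sets of vertices; deleting
   the edges of [M] is then the set difference [E :\: M] on the same vertices. *)

Definition edge_set (T : finType) (e : rel T) : {set {set T}} :=
  [set [set p.1; p.2] | p : T * T & (p.1 != p.2) && e p.1 p.2].

Definition graph_iso (T1 T2 : finType) (E1 : {set {set T1}})
    (E2 : {set {set T2}}) : Prop :=
  exists f : T1 -> T2, bijective f /\
    forall x y : T1, ([set x; y] \in E1) = ([set f x; f y] \in E2).

Definition perfect_matching (T : finType) (E M : {set {set T}}) : Prop :=
  [/\ M \subset E, trivIset M & cover M = [set: T]].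

Definition bitstring (n : nat) : finType := {ffun 'I_n -> bool}.

Definition complement (n : nat) (x : bitstring n) : bitstring n :=
  [ffun i => ~~ x i].

Definition diff_positions (n : nat) (x y : bitstring n) : {set 'I_n} :=
  [set i | x i != y i].

Definition hypercube (n : nat) : {set {set bitstring n}} :=
  edge_set (fun x y => #|diff_positions x y| == 1).

Definition complementary_edges (n : nat) : {set {set bitstring n}} :=
  edge_set (fun x y => y == complement x).

Definition folded_hypercube (n : nat) : {set {set bitstring n}} :=
  hypercube n :|: complementary_edges n.

Definition dimension_edges (n : nat) (i : 'I_n) : {set {set bitstring n}} :=
  edge_set (fun x y => diff_positions x y == [set i]).

(* Main.v *)
Require Import Defs.
From mathcomp Require Import all_boot.
From mathcomp Require Import perm.

(** [FQ_n] is the Cayley graph of (Z/2)^n on the n+1 generators e_1, ..., e_n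
    and e_1 + ... + e_n, whose only linear relation is that they sum to zero.
    For [n >= 4] a sum of two distinct generators therefore determines the
    pair, so two vertices at distance two have exactly two common neighbours.
    In [Q_n] every path x - y - z closes up to a 4-cycle; if [FQ_n - M] is
    isomorphic to [Q_n], the path u, u + s, u + s + a of [FQ_n - M] must close
    through u + a.  Hence the generator a matching u in [M] also matches every
    neighbour of u, and [M] consists of all edges of a single generator.
    Conversely, the linear involution swapping e_i with e_1 + ... + e_n and
    fixing the other e_j is an automorphism of [FQ_n] that exchanges [E^i] and
    [E_c]. *)

Set Implicit Arguments.
Unset Strict Implicit.
Unset Printing Implicit Defensive.

Lemma set2_inj (T : finType) (a b x y : T) :
  [set a; b] = [set x; y] -> (a = x /\ b = y) \/ (a = y /\ b = x).
Proof.
move=> eqS.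
have := set21 a b; have := set22 a b; rewrite eqS !inE.
have := set21 x y; have := set22 x y; rewrite -eqS !inE.
by do 4![case/orP=> /eqP ?]; subst; auto.
Qed.

Lemma mem_edge_set (T : finType) (e : rel T) (x y : T) :
  symmetric e -> ([set x; y] \in edge_set e) = (x != y) && e x y.
Proof.
move=> e_sym; apply/imsetP/idP => [[[a b]] /=|xy].
  by rewrite inE /= => ab /set2_inj[[-> ->] //|[-> ->]]; rewrite eq_sym e_sym.
by exists (x, y); rewrite ?inE.
Qed.

Lemma edge_setP (T : finType) (e : rel T) (B : {set T}) :
  B \in edge_set e -> exists x y, B = [set x; y].
Proof. by case/imsetP=> -[x y] _ ->; exists x, y. Qed.

(** * Generators and their translations *)

Section Directions.

Variable n : nat.
Implicit Types (x y z u v : bitstring n) (i j : 'I_n) (k l : option 'I_n).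

(* [Some i] stands for e_i and [None] for the all-ones generator. *)
Definition direction_bit k j : bool := if k is Some i then i == j else true.

Definition flip x k : bitstring n := [ffun j => x j (+) direction_bit k j].

Definition direction_edges k : {set {set bitstring n}} :=
  if k is Some i then dimension_edges i else complementary_edges n.

Lemma flipK k : involutive (flip^~ k).
Proof. by move=> x; apply/ffunP=> j; rewrite !ffunE addbK. Qed.

Lemma flipC x k l : flip (flip x k) l = flip (flip x l) k.
Proof. by apply/ffunP=> j; rewrite !ffunE addbAC. Qed.

Lemma flip_eq_sym x y k : (x == flip y k) = (y == flip x k).
Proof. by apply/eqP/eqP=> ->; rewrite flipK. Qed.

(** Connectivity as an induction principle: flipping a position where [x] and [y] differ lowers
    their Hamming distance. *)
Lemma flip_ind (P : bitstring n -> Prop) x y :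
  (forall u k, P u -> P (flip u k)) -> P x -> P y.
Proof.
move=> Pflip; have [m] := ubnP #|diff_positions x y|.
elim: m x => // m IHm x; rewrite ltnS => lem Px.
case: (pickP (mem (diff_positions x y))) => [i /= xyi|same]; last first.
  suff <- : x = y by [].
  by apply/ffunP=> j; apply/eqP/negbFE; have := same j; rewrite /= inE.
apply: (IHm (flip x (Some i))) (Pflip _ _ Px).
apply: leq_trans lem; apply: proper_card; apply/properP; split.
  apply/subsetP=> j; rewrite !inE ffunE /=.
  by have [<-|_] := eqVneq i j; [move: xyi; rewrite inE => -> | rewrite addbF].
exists i => //; move: xyi; rewrite !inE ffunE /= eqxx addbT.
by case: (x i); case: (y i).
Qed.

(** Positivity of [n] rules out loops: for [n = 0] the all-ones flip is the identity. *)
Lemma mem_direction_edges k x y : 0 < n ->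
  ([set x; y] \in direction_edges k) = (y == flip x k).
Proof.
move=> n_gt0; have irr : y == flip x k -> x != y.
  pose j0 : 'I_n := if k is Some i then i else Ordinal n_gt0.
  move/eqP->; apply/eqP=> /ffunP/(_ j0); rewrite ffunE /j0 /direction_bit.
  by case: k {j0} => [i|]; rewrite ?eqxx addbT; case: (x _).
have diffP : (y == flip x k)
    = [forall j, (x j != y j) == direction_bit k j].
  apply/eqP/forallP => [-> j|xy]; last apply/ffunP=> j.
    by rewrite ffunE; case: (x j) (direction_bit k j) => [] [].
  rewrite ffunE -(eqP (xy j)).
  by case: (x j); case: (y j).
case: k irr diffP => [i|] irr diffP; rewrite mem_edge_set.
- have -> : (diff_positions x y == [set i]) = (y == flip x (Some i)).
    rewrite diffP; apply/eqP/forallP => [/setP xy j|xy].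
      by have := xy j; rewrite !inE => ->; rewrite /= (eq_sym j).
    by apply/setP=> j; rewrite !inE (eqP (xy j)) /= eq_sym.
  by apply/andb_idl.
- by move=> u v; congr (_ == _); apply/setP=> j; rewrite !inE eq_sym.
- have -> : complement x = flip x None.
    by apply/ffunP=> j; rewrite !ffunE addbT.
  exact/andb_idl.
move=> u v; apply/eqP/eqP=> ->; apply/ffunP=> j; rewrite !ffunE negbK //.
Qed.

Lemma hypercubeE : hypercube n = \bigcup_i direction_edges (Some i).
Proof.
apply/setP=> B; apply/imsetP/bigcupP => [[[x y]]|[i _ /imsetP[[x y]]]].
  rewrite inE /= => /andP[xy /cards1P[i xyi]] ->; exists i => //.
  by apply/imsetP; exists (x, y); rewrite // inE xy xyi /=.
rewrite inE /= => /andP[xy /eqP xyi] ->.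
by exists (x, y); rewrite // inE xy /= xyi cards1.
Qed.

Lemma exists_notin (s : seq (option 'I_n)) :
  size s <= n -> exists k, k \notin s.
Proof.
move=> sn; have: #|s| < #|{: option 'I_n}|.
  by rewrite card_option card_ord ltnS (leq_trans (card_size _)).
rewrite ltnNge -(cardC (mem s)) -ltnNge -[X in X < _]addn0 ltn_add2l.
by case/card_gt0P=> k kN; exists k.
Qed.

Hypothesis n_ge4 : 4 <= n.

Let n_gt0 : 0 < n. Proof. exact: leq_trans n_ge4. Qed.

Lemma mem_hypercubeP x y :
  reflect (exists2 k, k != None & y = flip x k) ([set x; y] \in hypercube n).
Proof.
rewrite hypercubeE; apply: (iffP bigcupP) => [[i _]|[[i|] // _ yE]].
  by rewrite mem_direction_edges // => /eqP->; exists (Some i).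
by exists i => //; rewrite mem_direction_edges // yE.
Qed.

Lemma mem_folded_hypercubeP x y :
  reflect (exists k, y = flip x k) ([set x; y] \in folded_hypercube n).
Proof.
rewrite inE (mem_direction_edges None) //; apply: (iffP orP).
  case=> [/mem_hypercubeP[k _ ->]|/eqP->]; first by exists k.
  by exists None.
case=> -[i|] ->; last by right.
by left; apply/mem_hypercubeP; exists (Some i).
Qed.

Lemma folded_edgeP B :
  B \in folded_hypercube n -> exists x k, B = [set x; flip x k].
Proof.
move=> BF; have [x [y BE]] : exists x y, B = [set x; y].
  by move: BF; rewrite inE => /orP[] /edge_setP.
by move: BF; rewrite BE => /mem_folded_hypercubeP[k ->]; exists x, k.
Qed.

(* There are n + 1 >= 5 generators, so one of them is not among the four;
   comparing coefficients there shows that the relation is not the sum of all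
   generators, hence each generator occurs an even number of times. *)
Lemma flip4_eq x k l k' l' :
  flip (flip x k) l = flip (flip x k') l' -> k != l -> k' = k \/ k' = l.
Proof.
move=> eqx klN.
pose occ t := (t == k) (+) (t == l) (+) (t == k') (+) (t == l').
have bitE t j : direction_bit t j = (None == t) (+) (Some j == t).
  by case: t => [i|]; rewrite //= eq_sym.
have occE j : occ (Some j) = occ None.
  have /ffunP/(_ j) := eqx; rewrite !ffunE !bitE /occ.
  by case: (x j); do 8![case: (_ == _) => //].
have [o oN] := @exists_notin [:: k; l; k'; l'] n_ge4.
have occ0 t : occ t = false.
  have occNone : occ None = false.
    have <- : occ o = occ None by case: o {oN}.
    by move: oN; rewrite !inE !negb_or /occ => /and4P[] /negbTE-> /negbTE->
      /negbTE-> /negbTE->.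
  by case: t => // j; rewrite occE.
(* Both [k] and [l] must cancel against [k'] or [l']; if [k'] were neither, both would equal
   [l']. *)
have := occ0 k; have := occ0 l; rewrite /occ !eqxx (eq_sym l k) (negbTE klN) /=.
case: (l =P k') => [<-|_]; first by right.
case: (k =P k') => [<-|_]; first by left.
by move=> /negbFE/eqP ll' /negbFE/eqP kl'; rewrite ll' kl' eqxx in klN.
Qed.

(** If [k] and [l] acted alike, their sum would be zero, hence equal to [o + o] for a third
    generator [o], against [flip4_eq]. *)
Lemma flip_inj x : injective (flip x).
Proof.
move=> k l eqx; apply/eqP/negPn/negP=> klN.
have [o oN] := @exists_notin [:: k; l] (ltnW (ltnW n_ge4)).
have := @flip4_eq x k l o o; rewrite !flipK eqx flipK => /(_ erefl klN).
by move: oN; rewrite !inE => /norP[/eqP ? /eqP ?] [].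
Qed.

(** * Squares and rigidity of the matching *)

Lemma hypercube_square x y z :
  [set x; y] \in hypercube n -> [set y; z] \in hypercube n -> x != z ->
  exists2 w, w != y &
    ([set x; w] \in hypercube n) && ([set w; z] \in hypercube n).
Proof.
move=> /mem_hypercubeP[k kN ->] /mem_hypercubeP[l lN ->] xz.
exists (flip x l); last first.
  apply/andP; split; apply/mem_hypercubeP; first by exists l.
  by exists k; rewrite // flipC.
apply: contraNneq xz => /flip_inj->; apply/eqP.
by rewrite flipK.
Qed.

(** Covering gives the direction at [x], disjointness its uniqueness; the equation in [l] records
    both. *)
Lemma perfect_matching_direction (M : {set {set bitstring n}}) :
  perfect_matching (folded_hypercube n) M ->
  forall x, exists k, forall l, ([set x; flip x l] \in M) = (l == k).
Proof.
case=> /subsetP MF /trivIsetP Mtriv Mcover x.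
have: x \in cover M by rewrite Mcover inE.
case/bigcupP=> B BM xB.
have [k BE] : exists k, B = [set x; flip x k].
  have [y [k BE]] := folded_edgeP (MF _ BM); exists k.
  move: xB; rewrite BE => /set2P[]->//.
  by rewrite flipK setUC.
exists k => l; apply/idP/eqP => [lM|->]; last by rewrite -BE.
apply: (@flip_inj x); case: (eqVneq [set x; flip x l] B) => [|neqB].
  by rewrite BE => /set2_inj[[_ ->]|[xk ->]].
by have /pred0P/(_ x) := Mtriv _ _ lM BM neqB; rewrite /= xB set21.
Qed.

Lemma iso_hypercube_direction (M : {set {set bitstring n}}) :
  perfect_matching (folded_hypercube n) M ->
  graph_iso (folded_hypercube n :\: M) (hypercube n) ->
  exists k, M = direction_edges k.
Proof.
move=> pM [f [[g fK gK] fE]]; have dirM := perfect_matching_direction pM.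
have deletedP x y : reflect (exists2 k, [set x; flip x k] \notin M & y = flip x k)
    ([set x; y] \in folded_hypercube n :\: M).
  rewrite inE; apply: (iffP andP) => [[xyM /mem_folded_hypercubeP[k yE]]|].
    by exists k; rewrite -?yE.
  by case=> k kM ->; split=> //; apply/mem_folded_hypercubeP; exists k.
(* The path through [flip u k] closes up in [Q_n]. Pulled back along [g], the fourth vertex is a
   neighbour of [u] in direction [k] or [l]; [k] would give back the middle vertex, so the edge in
   direction [l] survives. *)
have square u k l : k != l -> [set u; flip u k] \notin M ->
    [set flip u k; flip (flip u k) l] \notin M -> [set u; flip u l] \notin M.
  move=> klN kM lM.
  have uk : [set u; flip u k] \in folded_hypercube n :\: M.
    by apply/deletedP; exists k.
  have kl : [set flip u k; flip (flip u k) l] \in folded_hypercube n :\: M.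
    by apply/deletedP; exists l.
  rewrite fE in uk; rewrite fE in kl.
  have ends : f u != f (flip (flip u k) l).
    apply: contraNneq klN => /(can_inj fK) /eqP; rewrite flip_eq_sym.
    by move/eqP/flip_inj->.
  have [w wN] := hypercube_square uk kl ends.
  rewrite -(gK w) -!fE => /andP[/deletedP[k' k'M wE] /deletedP[l' _]].
  rewrite wE => /flip4_eq/(_ klN) [k'E|<-] //.
  by rewrite -(gK w) wE k'E eqxx in wN.
have stable u k a : (forall l, ([set u; flip u l] \in M) = (l == a)) ->
    forall l, ([set flip u k; flip (flip u k) l] \in M) = (l == a).
  move=> ua; suff aM : [set flip u k; flip (flip u k) a] \in M.
    have [b ub] := dirM (flip u k) => l; rewrite ub.
    by move: aM; rewrite ub => /eqP->.
  have [->|kaN] := eqVneq k a; first by rewrite flipK setUC ua.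
  (* Were the [a]-edge at [flip u k] kept, the square would keep the [a]-edge at [u], which lies in
     [M]. *)
  by apply: contraT => /(square _ _ _ kaN); rewrite !ua eqxx kaN => /(_ isT).
pose x0 : bitstring n := [ffun=> false].
have [a x0a] := dirM x0; exists a.
pose P u := forall l, ([set u; flip u l] \in M) = (l == a).
have constM x : P x by apply: (flip_ind (P := P)) x0a => u k; apply: stable.
have [/subsetP MF _ _] := pM; apply/setP=> B; apply/idP/idP => [BM|].
  have [x [k BE]] := folded_edgeP (MF _ BM).
  move: BM; rewrite BE constM => /eqP->.
  by rewrite mem_direction_edges.
move=> Ba; have [x [y BE]] : exists x y, B = [set x; y].
  by case: (a) Ba => [i|] /edge_setP.
by move: Ba; rewrite BE mem_direction_edges // => /eqP->; rewrite constM.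
Qed.

(** Bit [i] is kept and controls the complementation of all other bits, so e_i and the all-ones
    vector are exchanged. For [None] the identity serves, as removing E_c leaves [Q_n] itself. *)
Definition swap_direction k x : bitstring n :=
  if k is Some i then [ffun j => x j (+) (i != j) && x i] else x.

Lemma swap_directionK k : involutive (swap_direction k).
Proof.
case: k => [i|] x //; apply/ffunP=> j; rewrite !ffunE eqxx /= addbF.
by rewrite addbK.
Qed.

(** By linearity, translation by a generator becomes translation by its image, and the generators
    are permuted by a transposition. *)
Lemma swap_direction_flip k x l :
  swap_direction k (flip x l) = flip (swap_direction k x) (tperm None k l).
Proof.
case: k => [i|]; last by rewrite tperm1 perm1.
apply/ffunP=> j; rewrite !ffunE.
case: tpermP => [->|->|lN liN] /=.
- by case: eqP => [<-|_]; case: (x j); case: (x i).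
- by rewrite eqxx; case: eqP => [<-|_]; case: (x j); case: (x i).
case: l lN liN => [l|] // _ liN /=.
have /negbTE-> : l != i by apply/eqP=> li; rewrite li in liN.
by rewrite addbF addbAC.
Qed.

Lemma direction_iso_hypercube k :
  graph_iso (folded_hypercube n :\: direction_edges k) (hypercube n).
Proof.
exists (swap_direction k); split.
  by exists (swap_direction k); apply: swap_directionK.
move=> x y; rewrite inE mem_direction_edges //.
apply/andP/mem_hypercubeP => [[ykN /mem_folded_hypercubeP[l yE]]|[l lN fyE]].
  exists (tperm None k l); last by rewrite yE swap_direction_flip.
  apply: contraNneq ykN => tlN.
  by rewrite yE -(tpermK None k l) tlN tpermL.
have yE : y = flip x (tperm None k l).
  apply: (inv_inj (swap_directionK k)).
  by rewrite swap_direction_flip tpermK.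
split; last by apply/mem_folded_hypercubeP; exists (tperm None k l).
rewrite yE; apply: contraNneq lN => /flip_inj tlk.
by rewrite -(tpermK None k l) tlk tpermR.
Qed.

End Directions.

Theorem theorem2p3 (n : nat) (hn : 4 <= n)
    (M : {set {set bitstring n}})
    (hM : perfect_matching (folded_hypercube n) M) :
  graph_iso (folded_hypercube n :\: M) (hypercube n) <->
  (M = complementary_edges n \/ exists i : 'I_n, M = dimension_edges i).
Proof.
split=> [/(iso_hypercube_direction hn hM)[[i|] ->]|].
- by right; exists i.
- by left.
case=> [->|[i ->]]; first exact: (direction_iso_hypercube hn None).
exact: (direction_iso_hypercube hn (Some i)).
Qed.
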